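(* Let $A$ be a nonempty finite set, let $\mathcal E$ be the class of stationary ergodic probability measures on $A^{\mathbb N}$ with its product $\sigma$-field $\mathcal F_\infty$, and let $\mathcal F_n=\sigma(X_1,\ldots,X_n)$ be the coordinate filtration. Let $H_0,H_1\subseteq\mathcal E$. If $(H_0,H_1)$ is uniformly testable, then it is asymmetrically testable. More precisely, if $(H_0,H_1)$ is uniformly testable, then for every $\alpha\in(0,1)$ there is a deterministic binary test $\psi^\alpha=(\psi_n^\alpha)_{n\ge1}$ that is asymmetrically consistent at level $\alpha$, uniformly consistent, and asymptotically consistent, and that satisfies the following uniform tail-error bound: there are strictly increasing sample sizes $(m_k^\alpha)_{k\ge1}$ in $\mathbb N$ such that $$\sup_{\rho\in H_i}\rho\bigl(\exists n\ge m_K^\alpha:\ \psi_n^\alpha\ne i\bigr)\le\alpha\,2^{-K}$$ for every $i\in\{0,1\}$ with $H_i\ne\varnothing$ and every $K\in\mathbb N$.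
   Context: $\mathbb N=\{1,2,\ldots\}$. $X_j:A^{\mathbb N}\to A$ is the coordinate map $X_j(x_1,x_2,\ldots)=x_j$, $\mathcal F_n=\sigma(X_1,\ldots,X_n)$ and $\mathcal F_\infty=\sigma(X_1,X_2,\ldots)$. With the shift $T(x_1,x_2,\ldots)=(x_2,x_3,\ldots)$, a probability measure $\rho$ on $(A^{\mathbb N},\mathcal F_\infty)$ is stationary ergodic if $\rho\circ T^{-1}=\rho$ and, for every $B\in\mathcal F_\infty$, $\rho(B\mathbin{\triangle}T^{-1}B)=0$ implies $\rho(B)\in\{0,1\}$. The sets $H_0,H_1$ may be empty and are not assumed disjoint. A deterministic binary test is a sequence $\eta=(\eta_n)_{n\ge1}$ of maps $\eta_n:A^{\mathbb N}\to\{0,1\}$ such that $\eta_n$ is $\mathcal F_n$-measurable for each $n$ (equivalently, $\eta_n$ is a function of the first $n$ coordinates). For $i\in\{0,1\}$, $\{\eta_n=i\text{ eventually}\}:=\bigcup_{N=1}^\infty\bigcap_{n=N}^\infty\{\eta_n=i\}$. Uniformly consistent (for $H_0$ against $H_1$): for every $\varepsilon>0$ there is $N\in\mathbb N$ such that for every $n\ge N$, every $i\in\{0,1\}$ and every $\rho\in H_i$, $\rho(\eta_n\ne i)<\varepsilon$. The pair $(H_0,H_1)$ is uniformly testable if a uniformly consistent deterministic binary test exists. Asymmetrically consistent at level $\alpha\in(0,1)$: $\rho(\eta_n=1)\le\alpha$ for all $\rho\in H_0$ and all $n\in\mathbb N$, and $\rho(\eta_n=1\text{ eventually})=1$ for all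 $\rho\in H_1$. The pair $(H_0,H_1)$ is asymmetrically testable if there is a family $(\psi^\alpha)_{\alpha\in(0,1)}$ of deterministic binary tests such that, for each $\alpha\in(0,1)$, $\psi^\alpha$ is asymmetrically consistent at level $\alpha$ (no compatibility across levels is required). Asymptotically consistent: $\rho(\eta_n=i\text{ eventually})=1$ for every $i\in\{0,1\}$ and every $\rho\in H_i$. *)

(* Defs.v *)
From HB Require Import structures.
From mathcomp Require Import all_boot all_order all_algebra.
From mathcomp Require Import all_classical all_reals all_analysis.

Set Implicit Arguments.
Unset Strict Implicit.
Unset Printing Implicit Defensive.
Import Order.TTheory GRing.Theory Num.Theory.

Local Open Scope classical_set_scope.
Local Open Scope ring_scope.

(* A^N, with the coordinates numbered from 0: x j is the letter x_(j+1). The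
   nonemptiness of A is carried by the type because a measurableType must be
   pointed. *)
Definition seqspace (A : finType) (hA : (0 < #|A|)%N) : Type := nat -> A.

HB.instance Definition _ (A : finType) (hA : (0 < #|A|)%N) :=
  Choice.copy (seqspace hA) (nat -> A).
HB.instance Definition _ (A : finType) (hA : (0 < #|A|)%N) :=
  isPointed.Build (seqspace hA) (fun=> enum_val (Ordinal hA)).

Section path_space.
Context (A : finType) (hA : (0 < #|A|)%N).

Definition seqcoord (j : nat) (x : seqspace hA) : A := x j.

(* The events {X_(j+1) \in B}, for j in D and B a subset of A. *)
Definition coord_events (D : set nat) : set (set (seqspace hA)) :=
  \bigcup_(j in D) preimage_set_system setT (seqcoord j) [set: set A].

(* The measurable spaces (A^N, F_n), with F_n generated by the coordinates
   numbered 0, ..., n - 1, and (A^N, F_oo). *)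
Definition Omega_upto (n : nat) := g_sigma_algebraType (coord_events `I_n).
Definition Omega := g_sigma_algebraType (coord_events [set: nat]).

Definition seqshift (x : Omega) : Omega := fun j => x j.+1.

Context (R : realType).

(* Both conditions are restricted to measurable sets: a measure is a function
   on all sets whose values outside the sigma-algebra are unconstrained. *)
Definition stationary (rho : probability Omega R) : Prop :=
  forall B : set Omega, measurable B -> pushforward rho seqshift B = rho B.

Definition ergodic (rho : probability Omega R) : Prop :=
  forall B : set Omega, measurable B ->
    rho (B `+` seqshift @^-1` B) = 0%E -> rho B = 0%E \/ rho B = 1%E.

Definition stationary_ergodic : set (probability Omega R) :=
  [set rho | stationary rho /\ ergodic rho].

(* Sample sizes start at 1; eta 0 is a dummy value that no definition below
   constrains or uses. The outcomes 0 and 1 are false and true. *)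
Definition binary_test (eta : nat -> Omega -> bool) : Prop :=
  forall n, (0 < n)%N -> measurable_fun [set: Omega_upto n] (eta n).

Definition eventually_eq (eta : nat -> Omega -> bool) (i : bool) : set Omega :=
  \bigcup_(N in [set N | (0 < N)%N]) \bigcap_(n in [set n | (N <= n)%N])
    [set x | eta n x = i].

Context (H0 H1 : set (probability Omega R)).

Definition hyp (i : bool) : set (probability Omega R) := if i then H1 else H0.

Definition uniformly_consistent (eta : nat -> Omega -> bool) : Prop :=
  forall eps : R, 0 < eps ->
    exists2 N, (0 < N)%N &
      forall n, (N <= n)%N -> forall i rho, hyp i rho ->
        (rho [set x | eta n x <> i] < eps%:E)%E.

Definition asymmetrically_consistent (alpha : R) (eta : nat -> Omega -> bool)
    : Prop :=
  (forall rho, H0 rho -> forall n, (0 < n)%N ->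
     (rho [set x | eta n x = true] <= alpha%:E)%E) /\
  (forall rho, H1 rho -> rho (eventually_eq eta true) = 1%E).

Definition asymptotically_consistent (eta : nat -> Omega -> bool) : Prop :=
  forall i rho, hyp i rho -> rho (eventually_eq eta i) = 1%E.

Definition uniformly_testable : Prop :=
  exists eta, binary_test eta /\ uniformly_consistent eta.

Definition asymmetrically_testable : Prop :=
  exists psi : R -> nat -> Omega -> bool,
    forall alpha, 0 < alpha < 1 ->
      binary_test (psi alpha) /\ asymmetrically_consistent alpha (psi alpha).

(* The sequence m is also only used at indices k >= 1. *)
Definition uniform_tail_bound (alpha : R) (eta : nat -> Omega -> bool)
    (m : nat -> nat) : Prop :=
  forall i, hyp i !=set0 -> forall K, (0 < K)%N ->
    (ereal_sup [set rho [set x | exists n, (m K <= n)%N /\ eta n x <> i]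
               | rho in hyp i] <= (alpha * 2 ^- K)%:E)%E.

Definition sample_sizes (m : nat -> nat) : Prop :=
  (forall k, (0 < k)%N -> (0 < m k)%N) /\
  (forall k l, (0 < k)%N -> (k < l)%N -> (m k < m l)%N).

End path_space.

Arguments stationary_ergodic {A} hA R _.

(* Main.v *)
Require Import Defs.
From mathcomp Require Import all_boot all_order all_algebra.
From mathcomp Require Import all_classical all_reals all_analysis.
Import Order.TTheory GRing.Theory Num.Theory.

Local Open Scope classical_set_scope.
Local Open Scope ring_scope.

(** A uniformly consistent test errs with small probability at each single
    large sample size, but may err at infinitely many of them: its error bounds
    need not be summable.  They become summable after slowing the test down.  Choose
    sample sizes m_1 < m_2 < ... such that, over all of H_0 and H_1, the error
    probability of eta at m_k is below alpha 2^-(k+1), and let psi_n repeat the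
    decision eta_(m_k) for m_k <= n < m_(k+1), answering 0 before m_1.  The
    value psi_n depends on the first m_k <= n letters only, so psi is again a
    test.  All the errors of psi from time m_K on are errors of eta at some m_k
    with k >= K, so that their union has probability at most
    alpha (2^-(K+1) + 2^-(K+2) + ...) = alpha 2^-K, which is the tail bound
    [slowed_tail].

    The remaining claims follow from the tail bound.  An error at time n
    is part of the tail event from any m_K <= n, hence uniform consistency;
    failing to be eventually right means lying in all tail events at once, hence
    asymptotic consistency; and a false rejection of H_0 occurs with probability
    0 before m_1 and at most alpha / 2 afterwards. *)

(** * Slowing down along a sequence of sample sizes *)

(** For strictly increasing m and m_0 <= n, the index k such that
    m_k <= n < m_(k+1).  Bounding k by n makes the maximum finite and loses
    nothing, because k <= m_k. *)
Definition block (m : nat -> nat) (n : nat) : nat :=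
  (\max_(k < n.+1 | (m k <= n)%N) k)%N.

Lemma blockP (m : nat -> nat) (K n : nat) :
  {homo m : i j / (i < j)%N} -> (m K <= n)%N ->
  (K <= block m n)%N /\ (m (block m n) <= n)%N.
Proof.
move=> m_incr mKn.
have K_le : (K <= m K)%N.
  elim: {mKn} K => // K IH; exact: leq_ltn_trans IH (m_incr _ _ (ltnSn K)).
split.
  have Kn : (K < n.+1)%N by rewrite ltnS (leq_trans K_le).
  exact: (@leq_bigmax_cond _ (fun k : 'I_n.+1 => (m k <= n)%N)
            (fun k => k : nat) (Ordinal Kn)).
rewrite /block; apply: (big_ind (fun k => (m k <= n)%N)) => //.
  case: K mKn {K_le} => // K; apply: leq_trans.
  exact: ltnW (m_incr _ _ (ltn0Sn K)).
by move=> k l mk ml; rewrite /maxn; case: ifP.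
Qed.

Definition slowed (T : Type) (m : nat -> nat) (eta : nat -> T -> bool)
    (n : nat) : T -> bool :=
  if (n < m 1)%N then fun=> false else eta (m (block m n)).

Lemma slowedE {T : Type} {m : nat -> nat} (eta : nat -> T -> bool) {n : nat} :
  (m 1 <= n)%N -> slowed T m eta n = eta (m (block m n)).
Proof. by rewrite /slowed leqNgt => /negbTE->. Qed.

(** The partial sums of N work: they increase strictly because the summands are
    positive, and each of them dominates its last summand. *)
Lemma increasing_above (N : nat -> nat) : (forall k, (0 < N k)%N) ->
  exists m : nat -> nat,
    {homo m : i j / (i < j)%N} /\ (forall k, (N k <= m k)%N).
Proof.
move=> N_gt0; exists (fun k => \sum_(j < k.+1) N j)%N; split => [|k].
  apply: homo_ltn; first exact: ltn_trans.
  by move=> k; rewrite [ltnRHS]big_ord_recr /= -[ltnLHS]addn0 ltn_add2l.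
by rewrite big_ord_recr leq_addl.
Qed.

(** * Measurability of the error events *)

Section tests.
Context {R : realType} {A : finType} {hA : (0 < #|A|)%N}.
Implicit Types (eta psi : nat -> Omega hA -> bool) (rho : probability (Omega hA) R).

(** The filtration F_n increases with n and is contained in F_oo. *)
Lemma coord_sigmaS (D E : set nat) : D `<=` E ->
  <<s coord_events (hA := hA) D >> `<=` <<s coord_events (hA := hA) E >>.
Proof.
move=> DE; apply: sub_sigma_algebra2 => B [j Dj Bj].
by exists j => //; exact: DE.
Qed.

Lemma measurable_upto (n p : nat) (f : Omega hA -> bool) : (n <= p)%N ->
  measurable_fun [set: Omega_upto hA n] f ->
  measurable_fun [set: Omega_upto hA p] f.
Proof.
move=> np mf _ Y mY; apply: (coord_sigmaS `I_n); last exact: mf.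
by move=> j /= jn; exact: leq_trans jn np.
Qed.

Definition error eta (i : bool) (n : nat) : set (Omega hA) :=
  [set x | eta n x <> i].

Lemma measurable_error {eta} i {n : nat} :
  binary_test eta -> (0 < n)%N -> measurable (error eta i n).
Proof.
move=> meta n0.
have -> : error eta i n = [set: Omega hA] `&` eta n @^-1` [set ~ i].
  by rewrite setTI.
apply: (coord_sigmaS `I_n) => //; exact: meta.
Qed.

Lemma slowed_test {m eta} : {homo m : i j / (i < j)%N} ->
  (forall k, (0 < m k)%N) -> binary_test eta ->
  binary_test (slowed (Omega hA) m eta).
Proof.
move=> m_incr m_gt0 meta n n0; have [nm|mn] := ltnP n (m 1).
  by rewrite /slowed nm; exact: measurable_cst.
rewrite slowedE//; have [_ bn] := blockP _ _ _ m_incr mn.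
exact: measurable_upto bn (meta _ (m_gt0 _)).
Qed.

(** * Tail events *)

Definition tail_error eta (i : bool) (N : nat) : set (Omega hA) :=
  [set x | exists n, (N <= n)%N /\ eta n x <> i].

Lemma tail_errorE eta i N :
  tail_error eta i N = \bigcup_(n in [set n | (N <= n)%N]) error eta i n.
Proof.
by apply/seteqP; split => x [n] => [[Nn en]|Nn en]; exists n.
Qed.

Lemma measurable_tail_error {eta} i {N : nat} :
  binary_test eta -> (0 < N)%N -> measurable (tail_error eta i N).
Proof.
move=> meta N0; rewrite tail_errorE; apply: bigcup_measurable => n /= Nn.
exact: measurable_error meta (leq_trans N0 Nn).
Qed.

Lemma error_le_tail {eta rho} i {N n : nat} : binary_test eta ->
  (0 < N)%N -> (N <= n)%N ->
  (rho (error eta i n) <= rho (tail_error eta i N))%E.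
Proof.
move=> meta N0 Nn; apply: le_measure; rewrite ?inE.
- exact: measurable_error meta (leq_trans N0 Nn).
- exact: measurable_tail_error.
- by move=> x ex; exists n.
Qed.

(** The union bound: the slowed test can only repeat decisions taken at the
    sample sizes m_k, so countably many errors of geometrically decreasing
    probability cover its whole tail. *)
Lemma slowed_tail {m eta rho} {i : bool} {alpha : R} {K : nat} :
  {homo m : i j / (i < j)%N} -> (forall k, (0 < m k)%N) -> 0 < alpha ->
  binary_test eta ->
  (forall k, (rho (error eta i (m k)) <= (alpha * 2 ^- k.+1)%:E)%E) ->
  (0 < K)%N ->
  (rho (tail_error (slowed (Omega hA) m eta) i (m K)) <= (alpha * 2 ^- K)%:E)%E.
Proof.
move=> m_incr m_gt0 alpha0 meta err K0.
pose F j := error eta i (m (j + K)%N).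
have sub : tail_error (slowed (Omega hA) m eta) i (m K) `<=` \bigcup_j F j.
  move=> x [n [mKn]].
  have m1n : (m 1 <= n)%N.
    apply: leq_trans mKn; case: K K0 {F} => // -[//|K] _.
    exact: ltnW (m_incr _ _ _).
  have [Kb _] := blockP _ _ _ m_incr mKn.
  by rewrite slowedE// => ex; exists (block m n - K)%N; rewrite // /F /error subnK.
have c_ge0 : 0 <= alpha * 2 ^- K by rewrite mulr_ge0 ?ltW// invr_ge0 exprn_ge0.
(* The j-th error has probability at most c / 2^(j+1) with c = alpha 2^-K, and
   these bounds sum to c. *)
apply: le_trans (epsilon_trick0 xpredT c_ge0).
apply: le_trans (measure_sigma_subadditive _ _ _ sub) _.
- by move=> j; exact: measurable_error.
- by apply: measurable_tail_error => //; exact: slowed_test.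
apply: lee_nneseries => // j _; apply: le_trans (err _) _.
by rewrite lee_fin natrX -addSn addnC exprD invfM mulrA.
Qed.

Lemma geometric_lt (alpha eps : R) : 0 < alpha -> 0 < eps ->
  exists2 K, (0 < K)%N & alpha * 2 ^- K < eps.
Proof.
move=> alpha0 eps0; have e0 : 0 < eps / alpha by rewrite divr_gt0.
have [K _ HK] := near_infty_natSinv_expn_lt (PosNum e0).
exists K.+1 => //; have := HK K.+1 (leqnSn K).
by rewrite /= ltr_pdivlMr// mul1r mulrC.
Qed.

(** * Consequences of the tail bound *)

Section tail_bound.
Context {H0 H1 : set (probability (Omega hA) R)} {alpha : R}.
Context {psi : nat -> Omega hA -> bool} {m : nat -> nat}.
Hypotheses (alpha0 : 0 < alpha) (m_gt0 : forall k, (0 < m k)%N).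
Hypothesis mpsi : binary_test psi.
Hypothesis tail : forall i rho K, hyp H0 H1 i rho -> (0 < K)%N ->
  (rho (tail_error psi i (m K)) <= (alpha * 2 ^- K)%:E)%E.

Lemma tail_uniform : uniformly_consistent H0 H1 psi.
Proof.
move=> eps eps0; have [K K0 lt_eps] := geometric_lt _ _ alpha0 eps0.
exists (m K) => // n mn i rho Hrho.
apply: le_lt_trans (error_le_tail i mpsi (m_gt0 K) mn) _.
by apply: le_lt_trans (tail _ _ _ Hrho K0) _; rewrite lte_fin.
Qed.

(** Failing to be eventually i means lying in every tail event, and the
    probabilities of the tail events become arbitrarily small. *)
Lemma tail_asymptotic : asymptotically_consistent H0 H1 psi.
Proof.
move=> i rho Hrho.
have evC : eventually_eq psi i =
    ~` \bigcap_(N in [set N | (0 < N)%N]) tail_error psi i N.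
  rewrite setC_bigcap; apply: eq_bigcupr => N _.
  rewrite tail_errorE setC_bigcup; apply: eq_bigcapr => n _.
  by apply/seteqP; split => x /=; rewrite /error /= notK.
have mcap : measurable (\bigcap_(N in [set N | (0 < N)%N]) tail_error psi i N).
  by apply: bigcap_measurable => [|N N0]; [exists 1%N|exact: measurable_tail_error].
rewrite evC probability_setC// -[RHS]sube0; congr (_ - _)%E.
apply/eqP; rewrite eq_le measure_ge0 andbT; apply/lee_addgt0Pr => eps eps0.
rewrite add0e; have [K K0 lt_eps] := geometric_lt _ _ alpha0 eps0.
have mK := measurable_tail_error i mpsi (m_gt0 K).
apply: (@le_trans _ _ (rho (tail_error psi i (m K)))).
  apply: le_measure; rewrite ?inE//.
  by apply: bigcap_inf => /=.
by apply: le_trans (tail _ _ _ Hrho K0) _; rewrite lee_fin ltW.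
Qed.

(** Before m_1 the tail bound says nothing, and the level is respected because
    the test answers 0; from m_1 on it is respected because every false rejection
    belongs to the tail event from m_1. *)
Lemma tail_asymmetric : (forall n x, (n < m 1)%N -> psi n x = false) ->
  asymmetrically_consistent H0 H1 alpha psi.
Proof.
move=> early; split=> [rho Hrho n n0|rho Hrho]; last first.
  exact: (tail_asymptotic true).
have [nm|mn] := ltnP n (m 1).
  have -> : [set x | psi n x = true] = set0.
    by apply/seteqP; split => x //=; rewrite early.
  by rewrite measure0 lee_fin ltW.
have -> : [set x | psi n x = true] = error psi false n.
  by apply/seteqP; split => x; rewrite /error /=; case: (psi n x).
apply: le_trans (error_le_tail false mpsi (m_gt0 1) mn) _.
apply: le_trans (tail false rho 1%N Hrho isT) _.
by rewrite lee_fin ler_piMr ?(ltW alpha0)// expr1 invf_le1 ?ler1n ?ltr0n.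
Qed.

End tail_bound.

End tests.

(** * Choosing the sample sizes *)

Theorem corollary4p1 (R : realType) (A : finType) (hA : (0 < #|A|)%N)
    (H0 H1 : set (probability (Omega hA) R))
    (sH0 : H0 `<=` stationary_ergodic hA R)
    (sH1 : H1 `<=` stationary_ergodic hA R) :
  uniformly_testable H0 H1 ->
  asymmetrically_testable H0 H1 /\
  forall alpha : R, 0 < alpha < 1 ->
    exists psi : nat -> Omega hA -> bool,
      [/\ binary_test psi,
          asymmetrically_consistent H0 H1 alpha psi,
          uniformly_consistent H0 H1 psi,
          asymptotically_consistent H0 H1 psi &
          exists m : nat -> nat,
            sample_sizes m /\ uniform_tail_bound H0 H1 alpha psi m].
Proof.
move=> [eta [meta ueta]].
match goal with |- _ /\ ?P => suff tests : P end.
  split=> //.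
  have /choice[psi psiP] : forall alpha : R, exists psi : nat -> Omega hA -> bool,
      0 < alpha < 1 -> binary_test psi /\ asymmetrically_consistent H0 H1 alpha psi.
    move=> alpha; have [/tests[psi [mpsi apsi _ _ _]]|_] := boolP (0 < alpha < 1).
      by exists psi.
    (* Outside (0, 1) the level imposes nothing, and any test will do. *)
    by exists eta.
  by exists psi.
move=> alpha /andP[alpha0 _].
have /choice[N NP] : forall k, exists N, (0 < N)%N /\
    forall n, (N <= n)%N -> forall i rho, hyp H0 H1 i rho ->
      (rho (error eta i n) < (alpha * 2 ^- k.+1)%:E)%E.
  move=> k; have [|N N0 NP] := ueta (alpha * 2 ^- k.+1).
    by rewrite mulr_gt0 // invr_gt0 exprn_gt0.
  by exists N.
have [m [m_incr Nm]] := increasing_above N (fun k => (NP k).1).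
have m_gt0 k : (0 < m k)%N by apply: leq_trans (Nm k); exact: (NP k).1.
have mpsi := slowed_test m_incr m_gt0 meta.
have tail i rho K : hyp H0 H1 i rho -> (0 < K)%N ->
    (rho (tail_error (slowed _ m eta) i (m K)) <= (alpha * 2 ^- K)%:E)%E.
  move=> Hrho; apply: slowed_tail => // k.
  exact/ltW/((NP k).2 _ (Nm k) _ _ Hrho).
exists (slowed (Omega hA) m eta); split => //.
- by apply: (tail_asymmetric alpha0 m_gt0 mpsi tail) => n x nm; rewrite /slowed nm.
- exact: (tail_uniform alpha0 m_gt0 mpsi tail).
- exact: (tail_asymptotic alpha0 m_gt0 mpsi tail).
exists m; split; first by split => // k l _; exact: m_incr.
move=> i _ K K0; apply: ge_ereal_sup => _ [rho Hrho <-].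
exact: tail.
Qed.
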